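(* Let $E$ be a nonzero real Banach space, $S\colon E\rightrightarrows E^*$ be closed, monotone and quasidense, and $(z^*,z^{**})\in E^*\times E^{**}$. Then the following are equivalent: (a) $(z^*,z^{**})\in G(S^{\mathbb F})$; (b) $\varphi_S^{**}(z^{**},\widehat{z^*})=\langle z^*,z^{**}\rangle$; (c) for all $w^*\in E^*$ there exists a sequence $\{(s_n,s_n^* )\}_{n\ge1}$ in $G(S)$ with $\langle s_n,s_n^*-w^*\rangle\to\langle z^*-w^*,z^{**}\rangle$ and $\|s_n^*-z^*\|\to0$; (d) for all $(w,w^* )\in E\times E^*$ there exists a sequence $\{(s_n,s_n^* )\}_{n\ge1}$ in $G(S)$ with $\langle s_n-w,s_n^*-w^*\rangle\to\langle z^*-w^*,z^{**}-\widehat w\rangle$ and $\|s_n^*-z^*\|\to0$.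
   Context: $\widehat w\in E^{**}$, $\widehat{z^*}\in E^{***}$ are canonical images. For a multifunction $S\colon E\rightrightarrows E^*$ with nonempty graph: closed means $G(S)$ norm-closed; monotone means $\langle s-t,s^*-t^*\rangle\ge0$ on $G(S)$; quasidense means for every $(x,x^* )$, $\inf_{(s,s^* )\in G(S)}[\tfrac12\|s-x\|^2+\tfrac12\|s^*-x^*\|^2+\langle s-x,s^*-x^*\rangle]\le0$. $\varphi_S(x,x^* )=\sup_{(s,s^* )\in G(S)}[\langle s,x^*\rangle+\langle x,s^*\rangle-\langle s,s^*\rangle]$; $\varphi_S^*$ is its conjugate on $E^*\times E^{**}$ under $\langle (x,x^* ),(y^*,y^{**})\rangle=\langle x,y^*\rangle+\langle x^*,y^{**}\rangle$, and $\varphi_S^{**}$ is the conjugate of $\varphi_S^*$ on $E^{**}\times E^{***}$ under $\langle (y^*,y^{**}),(x^{**},x^{***})\rangle=\langle y^*,x^{**}\rangle+\langle y^{**},x^{***}\rangle$. The Fitzpatrick extension $S^{\mathbb F}\colon E^*\rightrightarrows E^{**}$ is given by $(y^*,y^{**})\in G(S^{\mathbb F})$ iff $\varphi_S^*(y^*,y^{**})=\langle y^*,y^{**}\rangle$. *)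

(* Defs.v *)
From HB Require Import structures.
From mathcomp Require Import all_boot all_order all_algebra.
From mathcomp Require Import all_classical all_reals all_analysis.
Set Implicit Arguments. Unset Strict Implicit. Unset Printing Implicit Defensive.
Import Order.TTheory GRing.Theory Num.Theory.
Import numFieldNormedType.Exports.
Local Open Scope classical_set_scope.
Local Open Scope ring_scope.

(* Dual elements are represented as functions E -> R that are linear and
   bounded; bidual elements as functions (E -> R) -> R that are linear and
   bounded on the dual (their values off the dual are never used). *)
Section Banach.
Variables (R : realType) (E : normedModType R).

Definition is_dual (f : E -> R) : Prop :=
  (forall (a : R) (x y : E), f (a *: x + y) = a * f x + f y) /\
  exists M : R, forall x : E, `|f x| <= M * `|x|.

Definition dnorm (f : E -> R) : R :=
  sup [set `|f x| | x in [set x : E | `|x| <= 1]].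

Definition dsub (f g : E -> R) : E -> R := fun x => f x - g x.

Definition is_bidual (F : (E -> R) -> R) : Prop :=
  (forall (a : R) (f g : E -> R), is_dual f -> is_dual g ->
     F (fun x => a * f x + g x) = a * F f + F g) /\
  exists M : R, forall f : E -> R, is_dual f -> `|F f| <= M * dnorm f.

Definition hat (w : E) : (E -> R) -> R := fun f => f w.

(* A multifunction S from E to its dual is given by its graph G(S). *)
Definition graph_ok (G : set (E * (E -> R))) : Prop :=
  G `<=` [set p | is_dual p.2] /\ G !=set0.

(* G norm-closed in E x dual (with the max product norm; all product norms
   give the same topology). *)
Definition closed_graph (G : set (E * (E -> R))) : Prop :=
  forall (x : E) (xs : E -> R), is_dual xs ->
    (forall e : R, 0 < e -> exists2 p, G p &
        `|p.1 - x| < e /\ dnorm (dsub p.2 xs) < e) ->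
    G (x, xs).

Definition monotone_graph (G : set (E * (E -> R))) : Prop :=
  forall p q, G p -> G q -> 0 <= dsub p.2 q.2 (p.1 - q.1).

Definition quasidense_graph (G : set (E * (E -> R))) : Prop :=
  forall (x : E) (xs : E -> R), is_dual xs ->
    (ereal_inf [set ((2^-1 * `|p.1 - x| ^+ 2 + 2^-1 * dnorm (dsub p.2 xs) ^+ 2
                     + dsub p.2 xs (p.1 - x))%:E) | p in G] <= 0)%E.

Definition phiS (G : set (E * (E -> R))) (x : E) (xs : E -> R) : \bar R :=
  ereal_sup [set ((xs p.1 + p.2 x - p.2 p.1)%:E) | p in G].

Definition phiS_star (G : set (E * (E -> R))) (ys : E -> R)
    (yss : (E -> R) -> R) : \bar R :=
  ereal_sup [set ((ys q.1 + yss q.2)%:E - phiS G q.1 q.2)%E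
            | q in [set q : E * (E -> R) | is_dual q.2]].

(* second conjugate of phi_S, on E-bidual x E-tridual; a tridual point is
   given as a function ((E -> R) -> R) -> R (only the canonical image of
   z-star is ever used). *)
Definition phiS_star2 (G : set (E * (E -> R))) (xss : (E -> R) -> R)
    (xsss : ((E -> R) -> R) -> R) : \bar R :=
  ereal_sup [set ((xss q.1 + xsss q.2)%:E - phiS_star G q.1 q.2)%E
            | q in [set q : (E -> R) * ((E -> R) -> R) |
                     is_dual q.1 /\ is_bidual q.2]].

Definition hat2 (zs : E -> R) : ((E -> R) -> R) -> R := fun F => F zs.

Definition fitz_ext (G : set (E * (E -> R))) (ys : E -> R)
    (yss : (E -> R) -> R) : Prop :=
  phiS_star G ys yss = (yss ys)%:E.

End Banach.

(* Main.v *)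
(** Each of (a) and (b) implies that z = (zs, zss) is monotonically related to
    G: [<p - zs, s - zss> >= 0] for all (s, p) in G.  The core is that this
    relation implies (c); (c) then gives (a) and (b) by inserting the
    approximating points of G in the suprema defining the conjugates, and
    (c) <-> (d) is a shift by w.

    Let u = (f, F) be a point of the dual times the bidual.  Quasidensity at
    (0, f + t), where the functional t almost attains the norm of F, shows that
    the infimum over (s, p) in G of [<p - f, s - F>] is at most 0, with control
    on [|s|].  Using this at (1 - l) z + l u with l -> 0, and the relation of z
    to G, bounds that infimum by [<f - zs, F - zss>], even when restricted to
    [|s| <= |zss| + 1].  By a Hahn-Banach argument, these bounds for all F and
    all combinations f of ws and zs produce a single bounded y and a functional
    ys close to zs in norm, such that y is close to zss on ws and zs, and the
    Fitzpatrick function at (y, ys) is close to [<y, ys>].  Quasidensity at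
    (y, ys) finally yields a nearby point of G. *)
Require Import Defs.
From HB Require Import structures.
From mathcomp Require Import all_boot all_order all_algebra.
From mathcomp Require Import all_classical all_reals all_analysis.
From mathcomp Require Import ring lra.
Import Order.TTheory GRing.Theory Num.Theory.
Import numFieldNormedType.Exports.
Local Open Scope classical_set_scope.
Local Open Scope ring_scope.

Set Implicit Arguments.
Unset Strict Implicit.

(** * Sublinear functionals and a Hahn-Banach theorem with convex constraints *)

Section Sublinear.
Variables (R : realType) (V : lmodType R).
Implicit Types (p q L : V -> R) (u v : V) (C : set (V * R)).

Definition sublinear p :=
  (forall u v, p (u + v) <= p u + p v) /\
  (forall (t : R) v, 0 <= t -> p (t *: v) = t * p v).

Lemma sublinear0 p : sublinear p -> p 0 = 0.
Proof. by move=> [_ pZ]; rewrite -(scale0r 0) pZ// mul0r. Qed.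

Lemma sublinear_opp_ge0 p v : sublinear p -> 0 <= p v + p (- v).
Proof. by move=> sp; rewrite -(sublinear0 sp) -(subrr v); exact: sp.1. Qed.

Lemma sublinear_homog p :
  (forall (t : R) v, 0 < t -> p (t *: v) <= t * p v) -> p 0 = 0 ->
  forall (t : R) v, 0 <= t -> p (t *: v) = t * p v.
Proof.
move=> pZ p0 t v; rewrite le_eqVlt => /predU1P[<-|t0].
  by rewrite scale0r mul0r.
apply/eqP; rewrite eq_le pZ//=.
have := pZ t^-1 (t *: v); rewrite invr_gt0 => /(_ t0).
by rewrite scalerA mulVf ?gt_eqF// scale1r ler_pdivlMl.
Qed.

(** Take for [q v] the infimum of [p (v + t *: c.1) + t * c.2] over [t >= 0] and [c] in [C]. The
    last hypothesis keeps it above [- p (- v)]; [t = 0] gives [q <= p], and [t = 1] at [v = - c.1]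
    gives the constraint. *)
Lemma sublinear_shrink p C : sublinear p -> C !=set0 ->
  (forall c d (t : R), C c -> C d -> 0 <= t <= 1 ->
    C (t *: c.1 + (1 - t) *: d.1, t * c.2 + (1 - t) * d.2)) ->
  (forall c, C c -> 0 <= p c.1 + c.2) ->
  exists q, [/\ sublinear q, forall v, q v <= p v &
    forall c, C c -> q (- c.1) <= c.2].
Proof.
move=> sp [c0 Cc0] Cconv Cp; have [pD pZ] := sp.
pose A v := [set p (v + x.1 *: x.2.1) + x.1 * x.2.2 |
  x in [set x : R * (V * R) | 0 <= x.1 /\ C x.2]].
have Ap v t c : 0 <= t -> C c -> A v (p (v + t *: c.1) + t * c.2).
  by move=> t0 Cc; exists (t, c).
have A0 v : A v !=set0 by eexists; apply: (Ap v 0 c0).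
have lbA v : lbound (A v) (- p (- v)).
  move=> _ [[t c] /= [t0 Cc] <-].
  have := pD (v + t *: c.1) (- v); rewrite addrAC subrr add0r pZ// => h.
  by have := mulr_ge0 t0 (Cp _ Cc); lra.
have iA v : has_inf (A v) by split => //; eexists; exact: lbA.
have infA v t c : 0 <= t -> C c -> inf (A v) <= p (v + t *: c.1) + t * c.2.
  by move=> t0 Cc; apply: ge_inf; [exact: (iA v).2 | exact: Ap].
have qp v : inf (A v) <= p v.
  by have := infA v 0 c0 (lexx _) Cc0; rewrite scale0r addr0 mul0r addr0.
have qD u v : inf (A (u + v)) <= inf (A u) + inf (A v).
  rewrite -lerBlDr; apply: lb_le_inf => // _ [[t c] /= [t0 Cc] <-].
  rewrite lerBlDl -lerBlDr.
  apply: lb_le_inf => // _ [[s d] /= [s0 Cd] <-]; rewrite lerBlDr.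
  have [ts|ts] := ltP 0 (t + s); last first.
    have -> : t = 0 by lra.
    have -> : s = 0 by lra.
    rewrite !scale0r !mul0r !addr0; apply: le_trans (qp _) _.
    by rewrite addrC; exact: pD.
  have tsn : t + s != 0 by rewrite gt_eqF.
  (* Convexity merges the parameters [(t, c)] and [(s, d)] into [t + s] and the combination of [c]
     and [d] with weight [t / (t + s)]. *)
  have ti : 0 <= t / (t + s) <= 1.
    by rewrite divr_ge0 ?(ltW ts)//= ler_pdivrMr// mul1r; lra.
  have := infA (u + v) (t + s) _ (ltW ts) (Cconv _ _ _ Cc Cd ti).
  move=> /= /le_trans; apply.
  have e1 : (t + s) * (t / (t + s)) = t by field.
  have e2 : (t + s) * (1 - t / (t + s)) = s by field.
  rewrite scalerDr !scalerA e1 e2.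
  have -> : (t + s) * (t / (t + s) * c.2 + (1 - t / (t + s)) * d.2) =
    t * c.2 + s * d.2 by field.
  have -> : u + v + (t *: c.1 + s *: d.1) = (v + s *: d.1) + (u + t *: c.1).
    by rewrite addrACA (addrC (_ + _)).
  have := pD (v + s *: d.1) (u + t *: c.1); lra.
exists (fun v => inf (A v)); split => //.
- split; first exact: qD.
  apply: sublinear_homog => [t v t0|]; last first.
    apply/eqP; rewrite eq_le; apply/andP; split.
      by rewrite -(sublinear0 sp); exact: qp.
    by apply: lb_le_inf => // y /lbA; rewrite oppr0 (sublinear0 sp) oppr0.
  rewrite mulrC -ler_pdivrMr//.
  apply: lb_le_inf => // _ [[s d] /= [s0 Cd] <-].
  rewrite ler_pdivrMr// mulrDl mulrC -pZ ?(ltW t0)// scalerDr scalerA.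
  by rewrite mulrAC (mulrC s t); apply: infA => //; rewrite mulr_ge0// ltW.
- move=> c Cc; have := infA (- c.1) 1 c ler01 Cc.
  by rewrite scale1r addNr (sublinear0 sp) add0r mul1r.
Qed.

(* Applying sublinear_shrink to the single constraint (v, - p v) shows that a
   minimal sublinear functional satisfies p (- v) <= - p v. *)
Lemma minimal_sublinear p : sublinear p ->
  (forall q, sublinear q -> (forall v, q v <= p v) -> forall v, p v <= q v) ->
  forall v, p (- v) = - p v.
Proof.
move=> sp pmin v; apply/eqP; rewrite eq_le; apply/andP; split; last first.
  by have := sublinear_opp_ge0 v sp; lra.
have [|c d t -> -> _|_ ->|q [sq qp /(_ _ erefl) /= qv]] :=
    @sublinear_shrink p [set (v, - p v)] sp _.
- by exists (v, - p v).
- by rewrite /= -scalerDl -mulrDl subrKC scale1r mul1r.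
- by rewrite /= subrr.
- exact: le_trans (pmin q sq qp _) qv.
Qed.

(** Zorn's lemma: the pointwise infimum of a chain of sublinear functionals below [p] is finite,
    each of them being at least [- p (- v)], and is again sublinear. *)
Lemma sublinear_minorant p : sublinear p ->
  exists q, [/\ sublinear q, forall v, q v <= p v &
   forall r, sublinear r -> (forall v, r v <= q v) -> forall v, q v <= r v].
Proof.
move=> sp.
pose P q := sublinear q /\ forall v, q v <= p v.
pose T := {q | P q}.
have t0 : T by exists p; split.
(* The order is reversed, so that a maximal element is a minimal functional. *)
pose le_ (s t : T) := `[< forall v, sval t v <= sval s v >].
have [||A Atot|[q [sq qp]] qmin] := @ZL_preorder T t0 le_.
- by move=> t; apply/asboolP.
- move=> r s t /asboolP rs /asboolP st; apply/asboolP => v.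
  exact: le_trans (st v) (rs v).
- have [[a0 Aa0]|A0] := pselect (A !=set0); last first.
    by exists t0 => s As; case: A0; exists s.
  pose B v := [set sval s v | s in A].
  have B0 v : B v !=set0 by exists (sval a0 v), a0.
  have lbB v : lbound (B v) (- p (- v)).
    move=> _ [[s [ss sp']] _ <-] /=.
    by have := sublinear_opp_ge0 v ss; have := sp' (- v); lra.
  have infB v s : A s -> inf (B v) <= sval s v.
    by move=> As; apply: ge_inf; [eexists; exact: lbB | exists s].
  have sB : sublinear (fun v => inf (B v)).
    split=> [u v|].
      rewrite -lerBlDr; apply: lb_le_inf => // _ [s As <-].
      rewrite lerBlDl -lerBlDr; apply: lb_le_inf => // _ [t At <-].
      (* Of two members of the chain, the smaller one serves for both [u] and [v]. *)
      rewrite lerBlDr; have [/asboolP st|/asboolP ts] := Atot _ _ As At.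
        apply: le_trans (infB _ _ At) _; have := (svalP t).1.1 u v.
        by have := st u; lra.
      apply: le_trans (infB _ _ As) _; have := (svalP s).1.1 u v.
      by have := ts v; lra.
    apply: sublinear_homog => [t v t_gt0|].
      rewrite mulrC -ler_pdivrMr//; apply: lb_le_inf => // _ [s As <-].
      rewrite ler_pdivrMr// mulrC -(svalP s).1.2 ?(ltW t_gt0)//.
      exact: infB.
    apply/eqP; rewrite eq_le; apply/andP; split.
      by apply: le_trans (infB _ _ Aa0) _; rewrite (sublinear0 (svalP a0).1).
    by apply: lb_le_inf => // y /lbB; rewrite oppr0 (sublinear0 sp) oppr0.
  have Bp v : inf (B v) <= p v.
    by apply: le_trans (infB _ _ Aa0) _; exact: (svalP a0).2.
  exists (exist P _ (conj sB Bp)) => s As.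
  by apply/asboolP => v /=; exact: infB.
exists q; split => // r sr rq v.
have rp w : r w <= p w by exact: le_trans (rq w) (qp w).
have := qmin (exist P r (conj sr rp)).
by move=> /(_ (asboolT rq))/asboolP; exact.
Qed.

(** A minimal functional below the one from [sublinear_shrink] is odd, hence linear; oddness also
    turns [q (- c.1) <= c.2] into the last conclusion. *)
Lemma hahn_banach_convex p C : sublinear p -> C !=set0 ->
  (forall c d (t : R), C c -> C d -> 0 <= t <= 1 ->
    C (t *: c.1 + (1 - t) *: d.1, t * c.2 + (1 - t) * d.2)) ->
  (forall c, C c -> 0 <= p c.1 + c.2) ->
  exists L, [/\ forall (a : R) u v, L (a *: u + v) = a * L u + L v,
    forall v, L v <= p v & forall c, C c -> 0 <= L c.1 + c.2].
Proof.
move=> sp C0 Cconv Cp.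
have [q [sq qp qC]] := sublinear_shrink sp C0 Cconv Cp.
have [L [sL Lq Lmin]] := sublinear_minorant sq.
have LN := minimal_sublinear sL Lmin.
have LD u v : L (u + v) = L u + L v.
  apply/eqP; rewrite eq_le sL.1/=.
  have := sL.1 (- u) (- v); rewrite -opprD !LN; lra.
exists L; split => [a u v|v|c Cc].
- rewrite LD; congr (_ + _); have [a0|a0] := leP 0 a; first exact: sL.2.
  rewrite -[a]opprK scaleNr LN sL.2 ?oppr_ge0 ?(ltW a0)//.
  by rewrite opprK mulNr opprK.
- exact: le_trans (Lq v) (qp v).
- have := qC _ Cc; have := Lq (- c.1); rewrite LN; lra.
Qed.

End Sublinear.

(** * Norms on the dual and the bidual *)

Section Dual.
Variables (R : realType) (E : normedModType R).
Implicit Types (f g h : E -> R) (F H : (E -> R) -> R) (x y : E).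

Lemma is_dual_comb (a : R) f g : is_dual f -> is_dual g ->
  is_dual (fun x => a * f x + g x).
Proof.
move=> [lf [M fM]] [lg [N gN]]; split => [b x y|].
  by rewrite lf lg; ring.
exists (`|a| * M + N) => x; apply: le_trans (ler_normD _ _) _.
by rewrite normrM mulrDl -mulrA lerD// ler_wpM2l.
Qed.

Lemma is_dual0 : is_dual (fun _ : E => 0 : R).
Proof.
by split => [a x y|]; [rewrite mulr0 addr0|exists 0 => x; rewrite normr0 mul0r].
Qed.

Lemma is_dualZ (a : R) f : is_dual f -> is_dual (fun x => a * f x).
Proof.
move=> df; have := is_dual_comb a df is_dual0.
by under eq_fun do rewrite addr0.
Qed.

Lemma is_dual_dsub f g : is_dual f -> is_dual g -> is_dual (dsub f g).
Proof.
move=> df dg; have := is_dual_comb (-1) dg df.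
by under eq_fun do rewrite mulN1r addrC.
Qed.

Lemma dual0 f : is_dual f -> f 0 = 0.
Proof. by move=> [lf _]; have := lf (-1) 0 0; rewrite scaler0 addr0; lra. Qed.

Lemma dualB f x y : is_dual f -> f (x - y) = f x - f y.
Proof.
by move=> [lf _]; rewrite -scaleN1r addrC lf mulN1r addrC.
Qed.

Lemma dualZ (a : R) f x : is_dual f -> f (a *: x) = a * f x.
Proof. by move=> df; rewrite -[a *: x]addr0 df.1 dual0// addr0. Qed.

Let dset f := [set `|f x| | x in [set x : E | `|x| <= 1]].

Lemma has_sup_dnorm f : is_dual f -> has_sup (dset f).
Proof.
move=> [lf [M fM]]; split; first by exists `|f 0|, 0 => //=; rewrite normr0.
exists (Num.max M 0) => _ [x /= x1 <-]; apply: le_trans (fM x) _.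
have [M0|M0] := leP M 0; last by rewrite -[leRHS]mulr1 ler_wpM2l// ltW.
by rewrite mulr_le0_ge0.
Qed.

Lemma dual_norm_ge0 f : is_dual f -> 0 <= dnorm f.
Proof.
move=> df; apply: le_trans (normr_ge0 (f 0)) _.
by apply: (ub_le_sup (has_sup_dnorm df).2); exists 0 => //=; rewrite normr0.
Qed.

Lemma dual_le_dnorm f x : is_dual f -> `|f x| <= dnorm f * `|x|.
Proof.
move=> df; have [->|x0] := eqVneq x 0; first by rewrite dual0// !normr0 mulr0.
have nx : 0 < `|x| by rewrite normr_gt0.
rewrite -ler_pdivrMr//.
have -> : `|f x| / `|x| = `|f (`|x|^-1 *: x)|.
  by rewrite dualZ// normrM normfV normr_id mulrC.
apply: (ub_le_sup (has_sup_dnorm df).2); exists (`|x|^-1 *: x) => //=.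
by rewrite normrZ normfV normr_id mulVf// gt_eqF.
Qed.

Lemma dual_apply_le f x : is_dual f -> f x <= dnorm f * `|x|.
Proof. by move=> df; exact: le_trans (ler_norm _) (dual_le_dnorm x df). Qed.

Lemma dnorm_le f (C : R) : 0 <= C -> (forall x, `|f x| <= C * `|x|) ->
  dnorm f <= C.
Proof.
move=> C0 fC; apply: ge_sup; first by exists `|f 0|, 0 => //=; rewrite normr0.
by move=> _ [x /= x1 <-]; apply: le_trans (fC x) _; rewrite ler_piMr.
Qed.

Lemma dnorm_comb (a : R) f g : is_dual f -> is_dual g ->
  dnorm (fun x => a * f x + g x) <= `|a| * dnorm f + dnorm g.
Proof.
move=> df dg; apply: dnorm_le => [|x].
  by rewrite addr_ge0 ?mulr_ge0 ?dual_norm_ge0.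
apply: le_trans (ler_normD _ _) _; rewrite mulrDl normrM -mulrA.
by rewrite lerD ?ler_wpM2l ?dual_le_dnorm.
Qed.

Lemma dnorm0 : dnorm (fun _ : E => 0 : R) = 0.
Proof.
apply/eqP; rewrite eq_le dual_norm_ge0 ?andbT; last exact: is_dual0.
by apply: dnorm_le => // x; rewrite normr0 mul0r.
Qed.

Lemma dnormZ_le (a : R) f : is_dual f ->
  dnorm (fun x => a * f x) <= `|a| * dnorm f.
Proof.
move=> df; have := dnorm_comb a df is_dual0; rewrite dnorm0 addr0.
by under eq_fun do rewrite addr0.
Qed.

Lemma is_bidual_comb (a : R) F H : is_bidual F -> is_bidual H ->
  is_bidual (fun f => a * F f + H f).
Proof.
move=> [lF [M FM]] [lH [N HN]]; split => [b f g df dg|].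
  by rewrite lF// lH//; ring.
exists (`|a| * M + N) => f df; apply: le_trans (ler_normD _ _) _.
by rewrite normrM mulrDl -mulrA lerD ?ler_wpM2l ?FM ?HN.
Qed.

Lemma is_bidual_hat x : is_bidual (hat x).
Proof.
split => // ; exists `|x| => f df; rewrite mulrC; exact: dual_le_dnorm.
Qed.

Lemma bidual0 F : is_bidual F -> F (fun=> 0) = 0.
Proof.
move=> [lF _]; have := lF (-1) _ _ is_dual0 is_dual0.
under eq_fun do rewrite mulr0 addr0.
lra.
Qed.

Lemma bidualB F f g : is_bidual F -> is_dual f -> is_dual g ->
  F (dsub f g) = F f - F g.
Proof.
move=> [lF _] df dg; have := lF (-1) _ _ dg df.
by under eq_fun do rewrite mulN1r addrC; move=> ->; rewrite mulN1r addrC.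
Qed.

Lemma bidualZ F (a : R) f : is_bidual F -> is_dual f ->
  F (fun x => a * f x) = a * F f.
Proof.
move=> bF df; have := bF.1 a _ _ df is_dual0; rewrite bidual0// addr0.
by under eq_fun do rewrite addr0.
Qed.

Definition bnorm F : R :=
  sup [set `|F f| | f in [set f | is_dual f /\ dnorm f <= 1]].

Let bset F := [set `|F f| | f in [set f | is_dual f /\ dnorm f <= 1]].

Let bset0 F : bset F `|F (fun=> 0)|.
Proof.
by exists (fun=> 0) => //; split; [exact: is_dual0 | rewrite dnorm0].
Qed.

Lemma has_sup_bnorm F : is_bidual F -> has_sup (bset F).
Proof.
move=> [lF [M FM]]; split; first by eexists; exact: bset0.
exists (Num.max M 0) => _ [f /= [df f1] <-]; apply: le_trans (FM f df) _.
have [M0|M0] := leP M 0; last by rewrite -[leRHS]mulr1 ler_wpM2l// ltW.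
by rewrite mulr_le0_ge0// dual_norm_ge0.
Qed.

Lemma bnorm_ge0 F : is_bidual F -> 0 <= bnorm F.
Proof.
move=> bF; apply: le_trans (normr_ge0 (F (fun=> 0))) _.
exact: (ub_le_sup (has_sup_bnorm bF).2 (bset0 F)).
Qed.

Lemma bidual_le_bnorm F f : is_bidual F -> is_dual f ->
  `|F f| <= bnorm F * dnorm f.
Proof.
(* When [dnorm f] is 0, [f] cannot be normalised, but the bound in [is_bidual] already forces
   [F f = 0]. *)
move=> bF df; have [f0|f0] := eqVneq (dnorm f) 0.
  by have [M FM] := bF.2; have := FM f df; rewrite f0 !mulr0.
have nf : 0 < dnorm f by rewrite lt_neqAle eq_sym f0 dual_norm_ge0.
rewrite -ler_pdivrMr//.
have -> : `|F f| / dnorm f = `|F (fun x => (dnorm f)^-1 * f x)|.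
  by rewrite bidualZ// normrM normfV (gtr0_norm nf) mulrC.
apply: (ub_le_sup (has_sup_bnorm bF).2).
exists (fun x => (dnorm f)^-1 * f x) => //; split; first exact: is_dualZ.
by apply: le_trans (dnormZ_le _ df) _; rewrite normfV (gtr0_norm nf) mulVf.
Qed.

Lemma bidual_apply_ge F f : is_bidual F -> is_dual f ->
  - (bnorm F * dnorm f) <= F f.
Proof. by move=> bF df; have /ler_normlP[] := bidual_le_bnorm bF df; lra. Qed.

Lemma bidual_apply_le F f : is_bidual F -> is_dual f ->
  F f <= bnorm F * dnorm f.
Proof. by move=> bF df; have /ler_normlP[] := bidual_le_bnorm bF df; lra. Qed.

Lemma bnorm_comb (a : R) F H : is_bidual F -> is_bidual H ->
  bnorm (fun f => a * F f + H f) <= `|a| * bnorm F + bnorm H.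
Proof.
move=> bF bH; apply: ge_sup; first by eexists; exact: bset0.
move=> _ [f /= [df f1] <-]; apply: le_trans (ler_normD _ _) _.
rewrite normrM; apply: lerD.
  rewrite ler_wpM2l//; apply: le_trans (bidual_le_bnorm bF df) _.
  by rewrite ler_piMr// bnorm_ge0.
apply: le_trans (bidual_le_bnorm bH df) _.
by rewrite ler_piMr// bnorm_ge0.
Qed.

(** Choose [f] in the unit ball with [|F f|] within [e / (N + 1)] of the norm [N], and scale it by
    [N] times the sign of [F f]; the loss is then at most [N * (e / (N + 1)) <= e]. *)
Lemma bidual_almost_attains F (e : R) : is_bidual F -> 0 < e ->
  exists t, [/\ is_dual t, dnorm t <= bnorm F & bnorm F ^+ 2 - e <= F t].
Proof.
move=> bF e0; set N := bnorm F; have N0 : 0 <= N by exact: bnorm_ge0.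
have d0 : 0 < e / (N + 1) by rewrite divr_gt0// ltr_wpDl.
have [_ [f [df f1] <-] fN] := sup_adherent d0 (has_sup_bnorm bF).
pose s : R := Num.sg (F f) * N.
exists (fun x => s * f x); split; first exact: is_dualZ.
  apply: le_trans (dnormZ_le _ df) _.
  rewrite /s normrM (ger0_norm N0) mulrAC ler_piMl//.
  by rewrite mulr_ile1 ?dual_norm_ge0// normr_sg lern1 leq_b1.
rewrite bidualZ// /s mulrAC -normrEsg mulrC.
have {}fN : N - e / (N + 1) < `|F f| by [].
have eN : N * (e / (N + 1)) <= e.
  by rewrite mulrCA ler_piMr ?(ltW e0)// ler_pdivrMr; lra.
by have := ler_wpM2l N0 (ltW fN); rewrite mulrBr -expr2; lra.
Qed.

End Dual.

(** * Quasidensity tested at points of the dual times the bidual *)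

Section Quasidense.
Variables (R : realType) (E : normedModType R) (G : set (E * (E -> R))).
Hypotheses (Gdual : G `<=` [set p | is_dual p.2]) (Gqd : quasidense_graph G).

Lemma quasidense_ex (x : E) (xs : E -> R) (e : R) : is_dual xs -> 0 < e ->
  exists2 p, G p & 2^-1 * `|p.1 - x| ^+ 2 + 2^-1 * dnorm (dsub p.2 xs) ^+ 2
                     + dsub p.2 xs (p.1 - x) < e.
Proof.
move=> dx e0.
have [|_ [p Gp <-]] := @ereal_inf_lt _ _ e%:E (le_lt_trans (Gqd x dx) _).
  by rewrite lte_fin.
by rewrite lte_fin => pe; exists p.
Qed.

(* Quasidensity is applied at [(0, ys + t)], where [t] almost attains the norm
   of [F]. *)
Lemma quasidense_bidual (ys : E -> R) (F : (E -> R) -> R) (e : R) :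
  is_dual ys -> is_bidual F -> 0 < e ->
  exists p r, [/\ G p, dnorm (dsub p.2 ys) <= r + bnorm F &
    2^-1 * (`|p.1| - bnorm F) ^+ 2 + 2^-1 * (r - bnorm F) ^+ 2
    + (dsub p.2 ys p.1 - F (dsub p.2 ys)) <= e].
Proof.
move=> dy bF e0; set N := bnorm F.
have e20 : 0 < e / 2 by lra.
have [t [dt]] := bidual_almost_attains bF e20.
rewrite -/N => tN Ft.
have dyt : is_dual (fun x => 1 * t x + ys x) by exact: is_dual_comb.
have [p Gp] := quasidense_ex 0 dyt e20.
rewrite subr0; set v := dsub p.2 _ => pe.
have dp := Gdual Gp.
have dv : is_dual v by exact: is_dual_dsub.
have E1 : dsub p.2 ys = (fun x => 1 * v x + t x).
  by apply/funext => x; rewrite /v /dsub; ring.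
exists p, (dnorm v); split => //.
  by rewrite E1; apply: le_trans (dnorm_comb _ dv dt) _; rewrite normr1; lra.
rewrite E1 bF.1// !mul1r.
(* In the expanded squares, the cross terms [N * |p.1|] and [N * r] absorb the bounds on [t p.1] and
   [F v], and the two halves of [N ^+ 2] are compensated by [F t] up to [e / 2]. *)
have vF := bidual_apply_ge bF dv.
have tp := dual_apply_le p.1 dt.
have tp' : dnorm t * `|p.1| <= N * `|p.1| by rewrite ler_wpM2r.
rewrite -/N in vF.
nra.
Qed.

(** Several smallness conditions on [l] are met at once by adding their constants into [K]. *)
Lemma exists_small (K : R) : 0 <= K ->
  exists l, [/\ 0 < l, l <= 1 & l * K <= 1].
Proof.
move=> K0; exists (K + 1)^-1; split; rewrite ?invr_gt0 ?invf_le1; try lra.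
by rewrite mulrC ler_pdivrMr; lra.
Qed.

(* quasidense_bidual is applied to a point [(1 - l) z + l u] of the segment
   from [z = (zs, zss)] to [u = (- f, - H)], for [l] small. *)
Lemma quasidense_related (zs f : E -> R) (zss H : (E -> R) -> R) (e : R) :
  is_dual zs -> is_bidual zss -> is_dual f -> is_bidual H -> 0 < e ->
  (forall p, G p -> 0 <= dsub p.2 zs p.1 - zss (dsub p.2 zs)) ->
  exists p, [/\ G p, `|p.1| <= bnorm zss + 1 &
    p.2 p.1 - zss zs + H (dsub p.2 zs) + f p.1 - zss f <= e].
Proof.
move=> dz bz df bH e0 rel.
(* [(ds, dss)] is the direction [u - z], and [Q] is the duality pairing at it. *)
pose ds (x : E) : R := - 1 * f x + (- 1) * zs x.
have dds : is_dual ds by apply: is_dual_comb => //; exact: is_dualZ.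
have bz' : is_bidual (fun g => (- 1) * zss g).
  split=> [a g h dg dh|]; first by rewrite bz.1//; ring.
  by exists (bnorm zss) => g dg; rewrite mulN1r normrN; exact: bidual_le_bnorm.
pose dss (g : E -> R) : R := - 1 * H g + (- 1) * zss g.
have bds : is_bidual dss by exact: is_bidual_comb.
pose N := bnorm zss; pose D := bnorm dss; pose c := dnorm ds.
pose Q : R := dss ds.
have N0 : 0 <= N by exact: bnorm_ge0.
have D0 : 0 <= D by exact: bnorm_ge0.
have c0 : 0 <= c := dual_norm_ge0 dds.
(* [C] is large enough for the bound [B <= C * (1 + a + b)] below, where [B] is the first-order term
   in [l] and [a], [b] are the deviations controlled by quasidensity. *)
pose C := c * (N + D) + `|zss ds| + D * (2 * (N + D) + c) + c + D.
have C0 : 0 <= C.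
  by rewrite /C !addr_ge0 ?mulr_ge0 ?addr_ge0 ?mulr_ge0 ?addr_ge0.
have [|l [l0 l1 lK]] :=
    @exists_small (64 * C + 64 * (1 + `|Q|) + (1 + `|Q|) / e + 2 * D).
  have Q0 := normr_ge0 Q.
  have : 0 <= (1 + `|Q|) / e by apply: divr_ge0 (ltW e0); lra.
  lra.
have lC0 : 0 <= l * C by rewrite mulr_ge0 ?(ltW l0).
have lQ0 : 0 <= l * (1 + `|Q|) by rewrite mulr_ge0 ?addr_ge0 ?(ltW l0).
have lD0 : 0 <= l * D by rewrite mulr_ge0 ?(ltW l0).
have lQe0 : 0 <= l * (1 + `|Q|) / e by rewrite divr_ge0 ?(ltW e0).
have lK' : 64 * (l * C) + 64 * (l * (1 + `|Q|)) + l * (1 + `|Q|) / e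
    + 2 * (l * D) <= 1.
  by apply: le_trans lK; rewrite le_eqVlt; apply/orP; left; apply/eqP; ring.
have lC : l * C <= 1 / 64 by lra.
have lQ : l * (1 + `|Q|) <= 1 / 64 by lra.
have lD : l * D <= 1 / 2 by lra.
have lQe : l * (1 + `|Q|) <= e.
  have : l * (1 + `|Q|) / e <= 1 by lra.
  by rewrite ler_pdivrMr// mul1r.
pose ys (x : E) : R := l * ds x + zs x.
pose F (g : E -> R) : R := l * dss g + zss g.
have dys : is_dual ys by exact: is_dual_comb.
have bF : is_bidual F by exact: is_bidual_comb.
(* The error is taken of order [l ^+ 2], so that it remains small after division by [l]. *)
have l20 : 0 < l ^+ 2 by rewrite exprn_gt0.
have [p [r [Gp pr pe]]] := quasidense_bidual dys bF l20.
have dp := Gdual Gp.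
have dpz : is_dual (dsub p.2 zs) by exact: is_dual_dsub.
have dpy : is_dual (dsub p.2 ys) by exact: is_dual_dsub.
have A0 := rel p Gp.
set A := dsub p.2 zs p.1 - zss (dsub p.2 zs) in A0.
pose B := ds p.1 - zss ds + dss (dsub p.2 zs).
have XE : dsub p.2 ys p.1 - F (dsub p.2 ys) = A - l * B + l ^+ 2 * Q.
  have -> : dsub p.2 ys = (fun x => (- l) * ds x + dsub p.2 zs x).
    by apply/funext => x; rewrite /ys /dsub; ring.
  by rewrite /F bds.1// bz.1// /A /B /Q; ring.
rewrite XE in pe.
set N' := bnorm F in pr pe.
have N'0 : 0 <= N' by exact: bnorm_ge0.
have N'le : N' <= N + l * D.
  by have := bnorm_comb l bds bz; rewrite (gtr0_norm l0) addrC.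
have N'le2 : N' <= N + D by have := ler_piMl D0 l1; lra.
pose a := `| `|p.1| - N'|; pose b := `|r - N'|.
have pa : `|p.1| <= a + N' by rewrite -lerBlDr ler_norm.
have rb : r <= b + N' by rewrite -lerBlDr ler_norm.
have Bb : B <= C * (1 + a + b).
  have h1 := dual_apply_le p.1 dds.
  have h2 : - zss ds <= `|zss ds| by rewrite -normrN ler_norm.
  have h3 := bidual_apply_le bds dpz.
  have h4 : dnorm (dsub p.2 zs) <= c + (r + N').
    have -> : dsub p.2 zs = (fun x => l * ds x + dsub p.2 ys x).
      by apply/funext => x; rewrite /ys /dsub; ring.
    apply: le_trans (dnorm_comb _ dds dpy) _.
    by rewrite (gtr0_norm l0) lerD// ler_piMl.
  have h5 : c * `|p.1| <= c * (a + (N + D)) by rewrite ler_wpM2l//; lra.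
  have h6 : D * dnorm (dsub p.2 zs) <= D * (c + (b + 2 * (N + D))).
    by rewrite ler_wpM2l//; lra.
  have a0 : 0 <= a := normr_ge0 _.
  have b0 : 0 <= b := normr_ge0 _.
  have k1 : 0 <= (c * (N + D) + `|zss ds| + D * (2 * (N + D) + c) + D) * a.
    by rewrite mulr_ge0// !addr_ge0 ?mulr_ge0 ?addr_ge0 ?mulr_ge0 ?addr_ge0.
  have k2 : 0 <= (c * (N + D) + `|zss ds| + D * (2 * (N + D) + c) + c) * b.
    by rewrite mulr_ge0// !addr_ge0 ?mulr_ge0 ?addr_ge0 ?mulr_ge0 ?addr_ge0.
  have -> : C * (1 + a + b) = C + c * a + D * b
    + (c * (N + D) + `|zss ds| + D * (2 * (N + D) + c) + D) * a
    + (c * (N + D) + `|zss ds| + D * (2 * (N + D) + c) + c) * b.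
    by rewrite /C; ring.
  by rewrite -/c -/D in h1 h3; rewrite /B /C; lra.
have a2 : (`|p.1| - N') ^+ 2 = a ^+ 2 by rewrite /a real_normK ?num_real.
have b2 : (r - N') ^+ 2 = b ^+ 2 by rewrite /b real_normK ?num_real.
rewrite a2 b2 in pe.
have a0 : 0 <= a := normr_ge0 _.
have b0 : 0 <= b := normr_ge0 _.
have lQQ : - (l * (1 + `|Q|)) * l <= l ^+ 2 * Q - l ^+ 2.
  have : - `|Q| <= Q by rewrite lerNl -normrN ler_norm.
  by move=> /(ler_wpM2l (ltW l20)); lra.
exists p; split => //.
  have lB : l * B <= 1 / 64 * (1 + a + b).
    apply: le_trans (ler_wpM2l (ltW l0) Bb) _.
    by rewrite mulrA ler_wpM2r// !addr_ge0.
  have lQ1 : l * (1 + `|Q|) * l <= 1 / 64 by have := ler_piMr lQ0 l1; lra.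
  (* As [A >= 0], half of [a ^+ 2 + b ^+ 2] is at most [(2 + a + b) / 64], which forces
     [a <= 1 / 2]; with [N' <= N + 1 / 2] this bounds the norm of [p.1]. *)
  have ha : a <= 1 / 2.
    rewrite leNgt; apply/negP => ha.
    have : a * (1 / 2) <= a * a by rewrite ler_wpM2l// ltW.
    have := sqr_ge0 (b - 1 / 32); lra.
  by rewrite -/N; lra.
(* Dropping the squares leaves [A - l * B <= l ^+ 2 * (1 + |Q|) <= l * e]. Since [A >= 0] and
   [l <= 1], [A] may be replaced by [l * A], and then [l] cancels. *)
have lAB : l * (A - B) <= l * e.
  have : 0 <= a ^+ 2 by rewrite sqr_ge0.
  have : 0 <= b ^+ 2 by rewrite sqr_ge0.
  have : l * A <= A by rewrite ler_piMl.
  have : l * (1 + `|Q|) * l <= l * e by rewrite mulrC ler_wpM2l ?(ltW l0).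
  lra.
have : A - B <= e by rewrite -(ler_pM2l l0).
apply: le_trans; rewrite le_eqVlt; apply/orP; left; apply/eqP.
have zds : zss ds = - 1 * zss f + (- 1) * zss zs.
  by rewrite -(bidualZ (-1) bz dz) -bz.1//; exact: is_dualZ.
rewrite /A /B zds /dss.
have -> : zss (dsub p.2 zs) = zss p.2 - zss zs by rewrite bidualB.
by rewrite /ds /dsub; ring.
Qed.

End Quasidense.

(** * The dual as a real vector space *)

Section DualModule.
Variables (R : realType) (E : normedModType R).

Definition dual_pred : {pred E -> R} := fun f => `[< is_dual f >].

Lemma dual_submod_closed : GRing.submod_closed dual_pred.
Proof.
split; first by apply/asboolP; exact: is_dual0.
by move=> a f g /asboolP df /asboolP dg; apply/asboolP; exact: is_dual_comb.
Qed.

HB.instance Definition _ :=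
  GRing.isSubmodClosed.Build R (E -> R) dual_pred dual_submod_closed.

(** Bundling the dual gives it the [lmodType] structure over which [hahn_banach_convex] is
    stated. *)
Record dual_type := DualType {dual_fun : E -> R; _ : dual_fun \in dual_pred}.

HB.instance Definition _ := [isSub for dual_fun].
HB.instance Definition _ := [Choice of dual_type by <:].
HB.instance Definition _ := [SubChoice_isSubLmodule of dual_type by <:].

Lemma dual_funP (v : dual_type) : is_dual (dual_fun v).
Proof. by case: v => f df /=; apply/asboolP. Qed.

Lemma dual_funD u v x : dual_fun (u + v) x = dual_fun u x + dual_fun v x.
Proof. by rewrite [dual_fun _](raddfD val). Qed.

Definition to_dual f (df : is_dual f) : dual_type := DualType (asboolT df).

(** A linear functional below this multiple of the sum norm amounts to a bidual element and two real
    coefficients, which is how [related_mazur] uses it. *)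
Lemma sublinear_triple_norm (K : R) : 0 <= K ->
  sublinear (fun u : dual_type * R * R =>
    K * (dnorm (dual_fun u.1.1) + `|u.1.2| + `|u.2|)).
Proof.
move=> K0; split => [[[u a] b] [[v c] d]|t [[u a] b] t0] /=.
  rewrite -mulrDr ler_wpM2l//.
  have := dnorm_comb 1 (dual_funP u) (dual_funP v).
  have -> : (fun x => 1 * dual_fun u x + dual_fun v x) = dual_fun (u + v).
    by apply/funext => x; rewrite mul1r dual_funD.
  rewrite normr1 mul1r.
  have := ler_normD a c; have := ler_normD b d; lra.
rewrite mulrCA !normrM (ger0_norm t0); congr (_ * _); rewrite !mulrDr.
congr (_ + _ + _).
have dt : is_dual (t *: dual_fun u) := is_dualZ t (dual_funP u).
apply/eqP; rewrite eq_le; apply/andP; split.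
  by have := dnormZ_le t (dual_funP u); rewrite (ger0_norm t0).
(* The reverse inequality comes from scaling back by [t^-1], so [t = 0] is treated apart. *)
have [->|tn0] := eqVneq t 0; first rewrite mul0r.
  exact: (dual_norm_ge0 (is_dualZ 0 (dual_funP u))).
rewrite mulrC -ler_pdivlMr ?lt_neqAle ?t0 1?eq_sym ?tn0// mulrC.
have := dnormZ_le t^-1 dt.
have -> : (fun x => t^-1 * (t *: dual_fun u) x) = dual_fun u.
  by apply/funext => x; rewrite [(t *: _) x]/(t * _) mulrA mulVf// mul1r.
by rewrite ger0_norm ?invr_ge0.
Qed.

End DualModule.

(** * From the bidual back to [E] by a separation argument *)

Section Mazur.
Variables (R : realType) (E : normedModType R) (G : set (E * (E -> R))).
Hypotheses (Gdual : G `<=` [set p | is_dual p.2])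
  (Gmon : monotone_graph G) (Gqd : quasidense_graph G).
Variables (zs : E -> R) (zss : (E -> R) -> R).
Hypotheses (dz : is_dual zs) (bz : is_bidual zss)
  (rel : forall p, G p -> 0 <= dsub p.2 zs p.1 - zss (dsub p.2 zs)).

Lemma monotoneE p q : G p -> G q -> q.2 p.1 + p.2 q.1 - p.2 p.1 <= q.2 q.1.
Proof.
move=> Gp Gq; have := Gmon Gp Gq; rewrite /dsub.
rewrite (dualB _ _ (Gdual Gp)) (dualB _ _ (Gdual Gq)).
lra.
Qed.

(** Here [s] bounds the Fitzpatrick function at [(y, ys)]. If no triple works, the Hahn-Banach
    theorem applied to the convex set of all candidates gives a linear [L], made of [H] in the
    bidual and coefficients [al], [be]. Positivity on [C] contradicts [quasidense_related] for
    [f = al * ws + be * zs]. *)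
Lemma related_mazur (ws : E -> R) (K e : R) : is_dual ws -> 0 <= K -> 0 < e ->
  exists (y : E) (ys : E -> R) (s : R), [/\ is_dual ys,
    `|y| <= bnorm zss + 1,
    forall g, G g -> ys g.1 + g.2 y - g.2 g.1 <= s &
    K * (dnorm (dsub ys zs) + `|ws y - zss ws| + `|zs y - zss zs|)
      + (s - zss zs) <= e].
Proof.
move=> dw K0 e0; apply: contrapT => noy.
have dsz p : G p -> is_dual (dsub p.2 zs).
  by move=> Gp; apply: is_dual_dsub => //; exact: Gdual.
pose P y ys s := [/\ is_dual ys, `|y| <= bnorm zss + 1 &
  forall g, G g -> ys g.1 + g.2 y - g.2 g.1 <= s].
pose C := [set c : dual_type E * R * R * R | exists y ys s, P y ys s /\
  [/\ dual_fun c.1.1.1 = dsub ys zs, c.1.1.2 = ws y - zss ws,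
      c.1.2 = zs y - zss zs & c.2 = s - zss zs - e]].
(* By monotonicity, a point [p] of [G] is itself a candidate, with [s = p.2 p.1]. *)
have GC p (Gp : G p) : `|p.1| <= bnorm zss + 1 ->
    C (to_dual (dsz p Gp), ws p.1 - zss ws, zs p.1 - zss zs,
       p.2 p.1 - zss zs - e).
  move=> p1; exists p.1, p.2, (p.2 p.1); split => //.
  by split => // [|g Gg]; [exact: Gdual | exact: monotoneE].
have [|c d t [y1 [f1 [s1 [[df1 y1M fs1] [c1 c2 c3 c4]]]]]
    [y2 [f2 [s2 [[df2 y2M fs2] [d1 d2 d3 d4]]]]] /andP[t0 t1]||L [Llin Lp LC]] :=
  @hahn_banach_convex R _ _ C (sublinear_triple_norm E K0).
- have [p [Gp p1 _]] := quasidense_related Gdual Gqd dz bz (is_dual0 E)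
    (is_bidual_hat 0) e0 rel.
  by eexists; exact: (GC p Gp).
- exists (t *: y1 + (1 - t) *: y2), (fun x => t * f1 x + (1 - t) * f2 x),
    (t * s1 + (1 - t) * s2); split; [split|split] => /=.
  + by apply: is_dual_comb => //; exact: is_dualZ.
  + apply: le_trans (ler_normD _ _) _; rewrite !normrZ (ger0_norm t0).
    rewrite ger0_norm ?subr_ge0//.
    have t1' : 0 <= 1 - t by rewrite subr_ge0.
    have := ler_wpM2l t0 y1M; have := ler_wpM2l t1' y2M; lra.
  + move=> g Gg; have [lg _] := Gdual Gg.
    rewrite lg (dualZ _ _ (Gdual Gg)).
    have t1' : 0 <= 1 - t by rewrite subr_ge0.
    have := ler_wpM2l t0 (fs1 g Gg); have := ler_wpM2l t1' (fs2 g Gg); lra.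
  + apply/funext => x.
    transitivity (t * dual_fun c.1.1.1 x + (1 - t) * dual_fun d.1.1.1 x) => //.
    by rewrite c1 d1 /dsub; ring.
  + transitivity (t * c.1.1.2 + (1 - t) * d.1.1.2) => //.
    by rewrite c2 d2 dw.1 (dualZ _ _ dw); ring.
  + transitivity (t * c.1.2 + (1 - t) * d.1.2) => //.
    by rewrite c3 d3 dz.1 (dualZ _ _ dz); ring.
  + by rewrite c4 d4; ring.
- move=> c [y [f [s [[df yM fs] [-> -> -> ->]]]]].
  rewrite leNgt; apply/negP => h; apply: noy; exists y, f, s; split => //; lra.
(* [H] is the dual component of [L], with default value 0 off the dual. *)
pose H (g : E -> R) : R :=
  if pselect (is_dual g) is left dg then L (to_dual dg, 0, 0) else 0.
pose al := L (0, 1, 0); pose be := L (0, 0, 1).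
have L0 : L 0 = 0.
  by have := Llin (-1) 0 0; rewrite scaler0 addr0; lra.
have LE v a b : L (v, a, b) = L (v, 0, 0) + al * a + be * b.
  have -> : (v, a, b) = b *: (0, 0, 1) + (a *: (0, 1, 0) + (v, 0, 0)).
    transitivity (b *: 0 + (a *: 0 + v), b * 0 + (a * 1 + 0),
      b * 1 + (a * 0 + 0)) => //.
    by rewrite !mulr0 !mulr1 !scaler0 !add0r !addr0.
  by rewrite !Llin /al /be; ring.
have HE g (dg : is_dual g) : H g = L (to_dual dg, 0, 0).
  rewrite /H; case: pselect => // dg'.
  by congr (L (_, _, _)); apply/val_inj.
have bH : is_bidual H.
  split => [a f g df dg|].
    rewrite (HE _ df) (HE _ dg) (HE _ (is_dual_comb a df dg)) -Llin; congr L.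
    by congr (_, _, _); [exact/val_inj|rewrite /= scaler0 addr0..].
  exists K => f df; rewrite (HE _ df) ler_norml; apply/andP; split.
    have := Llin (-1) (to_dual df, 0, 0) 0; rewrite L0 !addr0 mulN1r => LN.
    have := Lp (-1 *: (to_dual df, 0, 0)).
    rewrite LN/= /GRing.scale/= mulr0 normr0.
    have := dnormZ_le (-1) df; rewrite normrN1 mul1r => h.
    rewrite !addr0 => h'; have := ler_wpM2l K0 h; lra.
  by have := Lp (to_dual df, 0, 0); rewrite /= normr0 !addr0.
have df : is_dual (fun x => al * ws x + be * zs x).
  by apply: is_dual_comb => //; exact: is_dualZ.
have e20 : 0 < e / 2 by lra.
(* The same expression is at most [e / 2] by this choice of [p], and at least [e] by positivity of
   [L] on [C]. *)
have [p [Gp p1]] := quasidense_related Gdual Gqd dz bz df bH e20 rel.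
have := LC _ (GC p Gp p1); rewrite /= LE -HE.
have -> : zss (fun x => al * ws x + be * zs x) = al * zss ws + be * zss zs.
  by rewrite bz.1 ?bidualZ//; exact: is_dualZ.
lra.
Qed.

End Mazur.

(** * Approximation by points of the graph *)

Section Equivalences.
Variables (R : realType) (E : normedModType R) (G : set (E * (E -> R))).
Hypotheses (Gdual : G `<=` [set p | is_dual p.2])
  (Gmon : monotone_graph G) (Gqd : quasidense_graph G).
Variables (zs : E -> R) (zss : (E -> R) -> R).
Hypotheses (dz : is_dual zs) (bz : is_bidual zss).

(** This is (c) for a single [ws], with one tolerance in place of a sequence. *)
Definition approximable (ws : E -> R) := forall e : R, 0 < e ->
  exists p, [/\ G p, `|zss (dsub zs ws) - dsub p.2 ws p.1| <= e &
    dnorm (dsub p.2 zs) <= e].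

(** At the pair [(y, ys)] of [related_mazur] the Fitzpatrick function nearly equals the pairing.
    Hence the pairing term in the quasidensity inequality there is almost nonnegative, and the
    squared distances to some [p] in [G] must be small. *)
Lemma related_approximable (ws : E -> R) : is_dual ws ->
  (forall p, G p -> 0 <= dsub p.2 zs p.1 - zss (dsub p.2 zs)) ->
  approximable ws.
Proof.
move=> dw rel e e0.
pose M := bnorm zss + 1; have M0 : 0 <= M by rewrite addr_ge0 ?bnorm_ge0.
have dzw : is_dual (dsub zs ws) by exact: is_dual_dsub.
pose c := dnorm (dsub zs ws); have c0 : 0 <= c := dual_norm_ge0 dzw.
have [|l [l0 l1 lK]] := @exists_small R ((2 * M + 6 + c) / e).
  by rewrite divr_ge0 ?(ltW e0)//; lra.
have le : l * (2 * M + 6 + c) <= e.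
  by move: lK; rewrite mulrA ler_pdivrMr// mul1r.
(* The squared distances will be at most [2 * (k + (M + 3) * k)], from the quasidensity error [k]
   and the gap [s - ys y <= (M + 3) * k]. *)
have [|k [k0 k1 kK]] := @exists_small R (2 * (M + 4) / l ^+ 2).
  by rewrite divr_ge0 ?sqr_ge0//; lra.
have kl2 : k * (2 * (M + 4)) <= l ^+ 2.
  by move: kK; rewrite mulrA ler_pdivrMr ?exprn_gt0// mul1r.
have kl : k <= l.
  by have := ler_piMl (ltW l0) l1; have := mulr_ge0 (ltW k0) M0; lra.
(* The weight [M + 2] outweighs the possible deficit [d1 * M + d3] of [s - zss zs], so that
   [d1 + d2 + d3 <= k] remains. *)
have K0 : 0 <= M + 2 by lra.
have [y [ys [s [dy yM ysG ys_e]]]] :=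
  related_mazur Gdual Gmon Gqd dz bz rel dw K0 k0.
rewrite -/M in yM.
have dyz : is_dual (dsub ys zs) by exact: is_dual_dsub.
have [p Gp pk] := quasidense_ex Gqd y dy k0.
have dp := Gdual Gp.
have dpy : is_dual (dsub p.2 ys) by exact: is_dual_dsub.
have dpz : is_dual (dsub p.2 zs) by exact: is_dual_dsub.
set d1 := dnorm (dsub ys zs) in ys_e.
set d2 := `|_ - zss ws| in ys_e; set d3 := `|_ - zss zs| in ys_e.
have d10 : 0 <= d1 := dual_norm_ge0 dyz.
have d20 : 0 <= d2 := normr_ge0 _.
have d30 : 0 <= d3 := normr_ge0 _.
have Md1 : dnorm (dsub ys zs) * `|y| <= d1 * M by rewrite ler_wpM2l.
have hy : - (d1 * M) <= ys y - zs y.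
  by have /ler_normlP[] := dual_le_dnorm y dyz; rewrite {1}/dsub; lra.
have hz : - d3 <= zs y - zss zs by rewrite /d3 lerNnormlW.
(* Quasidensity at [(y, ys)] puts the Fitzpatrick function above the pairing. *)
have ys_s : ys y <= s.
  apply/ler_addgt0Pr => t t0; have [g Gg gt] := quasidense_ex Gqd y dy t0.
  have := ysG g Gg; have := sqr_ge0 `|g.1 - y|.
  have := sqr_ge0 (dnorm (dsub g.2 ys)).
  by move: gt; rewrite /dsub !(dualB _ _ (Gdual Gg)) !(dualB _ _ dy); lra.
have Md2 : 0 <= M * d2 by exact: mulr_ge0.
have Md3 : 0 <= M * d3 by exact: mulr_ge0.
have Md10 : 0 <= d1 * M by exact: mulr_ge0.
have dk : d1 + d2 + d3 <= k by lra.
have kM0 : 0 <= k * M by rewrite mulr_ge0 ?(ltW k0).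
have sy : s <= ys y + (M + 3) * k.
  have : d1 * M <= k * M by rewrite ler_wpM2r//; lra.
  have : 0 <= M * d1 + M * d2 + M * d3 by rewrite !addr_ge0 ?mulr_ge0.
  lra.
have hp := ysG p Gp.
have {pk} pl : `|p.1 - y| ^+ 2 + dnorm (dsub p.2 ys) ^+ 2 <= l ^+ 2.
  by move: pk; rewrite {2}/dsub (dualB _ _ dp) (dualB _ _ dy); lra.
have pyl : `|p.1 - y| <= l.
  rewrite -(@ler_pXn2r _ 2)// ?nnegrE ?(ltW l0)//.
  by have := sqr_ge0 (dnorm (dsub p.2 ys)); lra.
have dpl : dnorm (dsub p.2 ys) <= l.
  rewrite -(@ler_pXn2r _ 2)// ?nnegrE ?(ltW l0) ?dual_norm_ge0//.
  by have := sqr_ge0 `|p.1 - y|; lra.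
have dpz2 : dnorm (dsub p.2 zs) <= 2 * l.
  have -> : dsub p.2 zs = (fun x => 1 * dsub p.2 ys x + dsub ys zs x).
    by apply/funext => x; rewrite /dsub; ring.
  by apply: le_trans (dnorm_comb _ dpy dyz) _; rewrite normr1 -/d1; lra.
have cl : 0 <= l * c by rewrite mulr_ge0 ?(ltW l0).
have Ml : 0 <= l * M by rewrite mulr_ge0 ?(ltW l0).
exists p; split => //; last by lra.
have p1M : `|p.1| <= M + 1.
  by have := ler_normD (p.1 - y) y; rewrite subrK; lra.
(* Each term on the right is small: the first two by closeness of [p] to [(zs, y)], the last two by
   [d3] and [d2]. *)
have -> : zss (dsub zs ws) - dsub p.2 ws p.1 =
    - dsub p.2 zs p.1 - dsub zs ws (p.1 - y) - (zs y - zss zs)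
    + (ws y - zss ws).
  by rewrite (dualB _ _ dzw) (bidualB bz)// /dsub; ring.
have h1 : `|dsub p.2 zs p.1| <= 2 * l * (M + 1).
  apply: le_trans (dual_le_dnorm _ dpz) _.
  by apply: ler_pM => //; exact: dual_norm_ge0.
have h2 : `|dsub zs ws (p.1 - y)| <= c * l.
  by apply: le_trans (dual_le_dnorm _ dzw) _; rewrite ler_wpM2l.
apply: le_trans (ler_normD _ _) _; rewrite -/d2.
apply: le_trans (lerD (ler_normB _ _) (lexx _)) _; rewrite -/d3.
have := ler_normB (- dsub p.2 zs p.1) (dsub zs ws (p.1 - y)).
rewrite normrN; lra.
Qed.

(** Tolerance [1 / (n + 1)] at stage [n]. The function [f] is left general to accommodate the shift
    by [w] in (d). *)
Lemma approximable_seq (f : E * (E -> R) -> R) (l : R) :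
  (forall e : R, 0 < e ->
    exists p, [/\ G p, `|l - f p| <= e & dnorm (dsub p.2 zs) <= e]) ->
  exists s : nat -> E * (E -> R), (forall n, G (s n)) /\
    ((fun n => f (s n)) @ \oo --> l) /\
    ((fun n => dnorm (dsub (s n).2 zs)) @ \oo --> (0 : R)).
Proof.
move=> h; have /choice[s sP] n : exists p, [/\ G p,
    `|l - f p| <= n.+1%:R^-1 & dnorm (dsub p.2 zs) <= n.+1%:R^-1].
  by apply: h; rewrite invr_gt0.
exists s; split; [|split].
- by move=> n; have [] := sP n.
- apply/cvgrPdist_le => e e0; near=> n.
  have [_ + _] := sP n; move/le_trans; apply; apply: ltW.
  by near: n; exact: (near_infty_natSinv_lt (PosNum e0)).
- apply/cvgrPdist_le => e e0; near=> n.
  have [Gs _ sn] := sP n.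
  rewrite sub0r normrN ger0_norm; last first.
    by apply: dual_norm_ge0; apply: is_dual_dsub => //; exact: Gdual.
  apply: (le_trans sn); apply: ltW.
  by near: n; exact: (near_infty_natSinv_lt (PosNum e0)).
Unshelve. all: by end_near. Qed.

Lemma seq_approximable (ws : E -> R) (s : nat -> E * (E -> R)) :
  (forall n, G (s n)) ->
  (fun n => dsub (s n).2 ws (s n).1) @ \oo --> zss (dsub zs ws) ->
  (fun n => dnorm (dsub (s n).2 zs)) @ \oo --> (0 : R) ->
  approximable ws.
Proof.
move=> Gs s1 s2 e e0.
have [n [n1 n2]] : exists n,
    `|zss (dsub zs ws) - dsub (s n).2 ws (s n).1| <= e /\
    `|0 - dnorm (dsub (s n).2 zs)| <= e.
  have /cvgrPdist_le/(_ e e0) h1 := s1.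
  have /cvgrPdist_le/(_ e e0) h2 := s2.
  by have [n] := filter_ex (filterI h1 h2); exists n.
exists (s n); split => //; apply: le_trans n2.
by rewrite sub0r normrN ler_norm.
Qed.

(** * The Fitzpatrick function and its conjugates *)

Lemma lee_EFin_approx (r : R) (X : \bar R) :
  (forall e : R, 0 < e -> exists2 s : R, (s%:E <= X)%E & r - e <= s) ->
  (r%:E <= X)%E.
Proof.
move=> h; apply/lee_addgt0Pr => e e0; have [s sX rs] := h e e0.
rewrite -leeBlDr//; apply: le_trans sX.
by rewrite -EFinB lee_fin.
Qed.

Lemma EFin_subel (a b : R) (X : \bar R) : ((a - b)%:E <= X)%E ->
  (a%:E - X <= b%:E)%E.
Proof.
case: X => [x| |]//.
  by rewrite -EFinB !lee_fin; lra.
by move=> _; rewrite /= leNye.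
Qed.

Lemma phiS_ge x xs p : G p -> ((xs p.1 + p.2 x - p.2 p.1)%:E <= phiS G x xs)%E.
Proof. by move=> Gp; apply: ereal_sup_ubound; exists p. Qed.

Lemma phiS_graph p : G p -> (phiS G p.1 p.2 <= (p.2 p.1)%:E)%E.
Proof.
move=> Gp; apply: ge_ereal_sup => _ [q Gq <-].
by rewrite lee_fin; exact: (monotoneE Gdual Gmon Gq Gp).
Qed.

Lemma phiS_star_ge ys yss p : G p ->
  ((ys p.1 + yss p.2 - p.2 p.1)%:E <= phiS_star G ys yss)%E.
Proof.
move=> Gp; apply: (@le_trans _ _ ((ys p.1 + yss p.2)%:E - phiS G p.1 p.2)%E).
  by rewrite EFinB leeD2l// leeN2 phiS_graph.
by apply: ereal_sup_ubound; exists p => //; exact: Gdual.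
Qed.

Lemma phiS_star_hat p : G p -> (phiS_star G p.2 (hat p.1) <= (p.2 p.1)%:E)%E.
Proof.
move=> Gp; apply: ge_ereal_sup => _ [[x xs] /= dxs <-]; apply: EFin_subel.
by apply: le_trans (phiS_ge x xs Gp); rewrite lee_fin /hat; lra.
Qed.

(** Quasidensity gives [p] in [G] with pairing at most [e] relative to [(ys, yss)]; inserting [p] in
    the supremum yields the bound up to [e]. *)
Lemma le_phiS_star ys yss : is_dual ys -> is_bidual yss ->
  ((yss ys)%:E <= phiS_star G ys yss)%E.
Proof.
move=> dy by_; apply: lee_EFin_approx => e e0.
have [p [r [Gp _ pe]]] := quasidense_bidual Gdual Gqd dy by_ e0.
eexists; first exact: (phiS_star_ge ys yss Gp).
move: pe; rewrite (bidualB by_ (Gdual Gp) dy) {1}/dsub.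
have := sqr_ge0 (`|p.1| - bnorm yss); have := sqr_ge0 (r - bnorm yss); lra.
Qed.

Lemma fitz_ext_related : fitz_ext G zs zss ->
  forall p, G p -> 0 <= dsub p.2 zs p.1 - zss (dsub p.2 zs).
Proof.
move=> a p Gp; have := phiS_star_ge zs zss Gp; rewrite a lee_fin.
by rewrite (bidualB bz (Gdual Gp) dz) /dsub; lra.
Qed.

(** The second conjugate is tested at [(p.2, hat p.1)], where [phiS_star_hat] bounds the first
    one. *)
Lemma phiS_star2_related : phiS_star2 G zss (hat2 zs) = (zss zs)%:E ->
  forall p, G p -> 0 <= dsub p.2 zs p.1 - zss (dsub p.2 zs).
Proof.
move=> b p Gp.
have : ((zss p.2 + zs p.1 - p.2 p.1)%:E <= (zss zs)%:E)%E.
  rewrite -b; apply: (@le_trans _ _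
    ((zss p.2 + hat2 zs (hat p.1))%:E - phiS_star G p.2 (hat p.1))%E).
    by rewrite EFinB leeD2l// leeN2 phiS_star_hat.
  apply: ereal_sup_ubound; exists (p.2, hat p.1) => //; split => /=.
    exact: Gdual.
  exact: is_bidual_hat.
by rewrite lee_fin (bidualB bz (Gdual Gp) dz) /dsub; lra.
Qed.

Lemma approximable_fitz_ext :
  (forall ws, is_dual ws -> approximable ws) -> fitz_ext G zs zss.
Proof.
move=> h; apply/eqP; rewrite eq_le le_phiS_star// andbT.
apply: ge_ereal_sup => _ [[x xs] /= dxs <-]; apply: EFin_subel.
apply: lee_EFin_approx => e e0.
(* One share of the tolerance goes to the pairing with [ws = xs], and [|x|] shares to
   [dsub p.2 zs x]. *)
have d0 : 0 < e / (1 + `|x|) by rewrite divr_gt0// ltr_pwDl.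
have [p [Gp p1 p2]] := h xs dxs _ d0.
eexists; first exact: (phiS_ge x xs Gp).
have dp := Gdual Gp.
move: p1; rewrite (bidualB bz dz dxs) => /ler_normlP[p1 _].
have : `|dsub p.2 zs x| <= e / (1 + `|x|) * `|x|.
  apply: le_trans (dual_le_dnorm _ (is_dual_dsub dp dz)) _.
  by rewrite ler_wpM2r.
move=> /ler_normlP[+ _].
have : e / (1 + `|x|) * (1 + `|x|) = e by rewrite divfK// gt_eqF// ltr_pwDl.
rewrite mulrDr mulr1; move: p1; rewrite /dsub; lra.
Qed.

Lemma approximable_phiS_star2 :
  (forall ws, is_dual ws -> approximable ws) ->
  phiS_star2 G zss (hat2 zs) = (zss zs)%:E.
Proof.
move=> h; apply/eqP; rewrite eq_le; apply/andP; split; last first.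
  (* Testing at [(zs, zss)] gives twice the pairing minus the first conjugate, which equals the
     pairing by (a). *)
  apply: (@le_trans _ _ ((zss zs + hat2 zs zss)%:E - phiS_star G zs zss)%E).
    by rewrite (approximable_fitz_ext h) -EFinB lee_fin addrK.
  by apply: ereal_sup_ubound; exists (zs, zss).
apply: ge_ereal_sup => _ [[ys yss] /= [dy by_] <-]; apply: EFin_subel.
apply: lee_EFin_approx => e e0.
have N0 := bnorm_ge0 by_.
have d0 : 0 < e / (1 + bnorm yss) by rewrite divr_gt0// ltr_pwDl.
have [p [Gp p1 p2]] := h ys dy _ d0.
eexists; first exact: (phiS_star_ge ys yss Gp).
have dp := Gdual Gp; have dpz := is_dual_dsub dp dz.
move: p1; rewrite (bidualB bz dz dy) => /ler_normlP[p1 _].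
have h1 := bidual_apply_ge by_ dpz.
have := ler_wpM2l N0 p2.
have : e / (1 + bnorm yss) * (1 + bnorm yss) = e.
  by rewrite divfK// gt_eqF// ltr_pwDl.
rewrite mulrDr mulr1 [_ * bnorm _]mulrC.
by move: h1 p1; rewrite (bidualB by_ dp dz) /hat2 /dsub; lra.
Qed.

End Equivalences.

Unset Implicit Arguments.
Set Strict Implicit.

Theorem theorem7p5 (R : realType) (E : completeNormedModType R)
  (G : set (E * (E -> R))) (zs : E -> R) (zss : (E -> R) -> R) :
  (exists x : E, x != 0) ->
  graph_ok G -> closed_graph G -> monotone_graph G -> quasidense_graph G ->
  is_dual zs -> is_bidual zss ->
  let a := fitz_ext G zs zss in
  let b := phiS_star2 G zss (hat2 zs) = (zss zs)%:E in
  let c := forall ws : E -> R, is_dual ws ->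
      exists s : nat -> E * (E -> R), (forall n, G (s n)) /\
        ((fun n => dsub (s n).2 ws (s n).1) @ \oo --> zss (dsub zs ws)) /\
        ((fun n => dnorm (dsub (s n).2 zs)) @ \oo --> (0 : R)) in
  let d := forall (w : E) (ws : E -> R), is_dual ws ->
      exists s : nat -> E * (E -> R), (forall n, G (s n)) /\
        ((fun n => dsub (s n).2 ws ((s n).1 - w)) @ \oo -->
            zss (dsub zs ws) - hat w (dsub zs ws)) /\
        ((fun n => dnorm (dsub (s n).2 zs)) @ \oo --> (0 : R)) in
  (a <-> b) /\ (a <-> c) /\ (a <-> d).
Proof.
move=> _ [Gdual _] _ Gmon Gqd dz bz a b c d.
pose approx := forall ws, is_dual ws -> approximable G zs zss ws.
have a_approx : a -> approx.
  by move=> /(fitz_ext_related Gdual Gmon dz bz) rel ws dw;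
    exact: related_approximable.
have approx_a : approx -> a by exact: approximable_fitz_ext.
have approx_b : approx -> b by exact: approximable_phiS_star2.
have b_approx : b -> approx.
  by move=> /(phiS_star2_related Gdual dz bz) rel ws dw;
    exact: related_approximable.
(* The shift by [w] adds the error [dsub p.2 zs w], at most the tolerance times the norm of [w]. *)
have approx_d : approx -> d.
  move=> h w ws dw; apply: (approximable_seq Gdual dz
    (f := fun p => dsub p.2 ws (p.1 - w))) => e e0.
  have d0 : 0 < e / (1 + `|w|) by rewrite divr_gt0// ltr_pwDl.
  have [p [Gp p1 p2]] := h ws dw _ d0.
  have dp := Gdual _ Gp; have dpz := is_dual_dsub dp dz.
  have ew : e / (1 + `|w|) * (1 + `|w|) = e.
    by rewrite divfK// gt_eqF// ltr_pwDl.
  rewrite mulrDr mulr1 in ew.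
  have ew0 : 0 <= e / (1 + `|w|) * `|w| by rewrite mulr_ge0 ?(ltW d0).
  exists p; split => //; last by lra.
  rewrite (dualB _ _ (is_dual_dsub dp dw)) /hat.
  have -> : zss (dsub zs ws) - dsub zs ws w
      - (dsub p.2 ws p.1 - dsub p.2 ws w) =
    (zss (dsub zs ws) - dsub p.2 ws p.1) + dsub p.2 zs w by rewrite /dsub; ring.
  apply: le_trans (ler_normD _ _) _; rewrite -[leRHS]ew; apply: lerD => //.
  by apply: le_trans (dual_le_dnorm _ dpz) _; rewrite ler_wpM2r.
have d_c : d -> c.
  move=> h ws dw; have [s [Gs [s1 s2]]] := h 0 ws dw.
  exists s; split => //; split => //; move: s1.
  rewrite /hat (dual0 (is_dual_dsub dz dw)) subr0.
  by under eq_fun do rewrite subr0.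
have c_approx : c -> approx.
  move=> h ws dw; have [s [Gs [s1 s2]]] := h ws dw.
  exact: seq_approximable s2.
by split; [|split]; split; auto.
Qed.
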